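(* Let $T>0$ and let $\alpha,\gamma\in C([0,T];(0,1))$ each satisfy $\sup_{t\in[0,T];\,|h|\le1}|h|^{\alpha(t)-\alpha(t+h)}<\infty$ and $\sup_{t\in[0,T];\,|h|\le1}|h|^{\gamma(t)-\gamma(t+h)}<\infty$, and suppose $$\beta:=\inf_{t\in[0,T]}\{\alpha(t)+\gamma(t)\}>1 .$$ Let $Y\in\mathcal C^{\gamma(\cdot)}$ and $X\in\mathcal C^{\alpha(\cdot)}$ be paths on $[0,T]$, and define $\Xi_{s,t}=Y_s(X_t-X_s)$. Then the integral $$(\mathcal I\Xi)_{s,t}:=\lim_{|\mathcal P|\to0}\sum_{[u,v]\in\mathcal P}\Xi_{u,v}$$ (limit over partitions $\mathcal P$ of $[s,t]$ with mesh $|\mathcal P|$) satisfies, for all $0\le s<t\le T$, $$|(\mathcal I\Xi)_{s,t}-\Xi_{s,t}|\le C_\beta\,\|Y\|_{\gamma(\cdot);[s,t]}\,\|X\|_{\alpha(\cdot);[s,t]}\,|t-s|^{\beta},$$ where $C_\beta$ is a constant not depending on $X,Y,s,t$.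
   Context: Suprema are over $h\neq0$ with $t,t+h\in[0,T]$. For $\alpha$ as in the claim and an interval $[a,b]\subset[0,T]$, $$\|g\|_{\alpha(\cdot);[a,b]}:=\sup_{t,t+h\in[a,b];\,0<|h|\le1}\frac{|g(t+h)-g(t)|}{|h|^{\alpha(t)}},$$ and $\mathcal C^{\alpha(\cdot)}$ is the space of functions on $[0,T]$ (with values in a finite-dimensional Euclidean space) with $\|g\|_{\alpha(\cdot);[0,T]}<\infty$. The values of $Y$ and $X$ are such that the product $Y_sX_{s,t}$ is defined (e.g. $X$ is $\mathbb R^d$-valued and $Y$ is matrix-valued). Subscripts on constants only indicate the dependence regarded as important; constants may otherwise depend on the fixed data $T,\alpha,\gamma$. *)

(* Defs.v *)
From mathcomp Require Export all_boot all_order all_algebra.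
From mathcomp Require Export all_classical all_reals all_analysis.

Set Implicit Arguments.
Unset Strict Implicit.
Unset Printing Implicit Defensive.
Import Order.TTheory GRing.Theory Num.Theory.
Import numFieldNormedType.Exports.

Local Open Scope classical_set_scope.
Local Open Scope ring_scope.

(* The library norm on matrices is the maximum norm; this is the Euclidean
   (Frobenius) norm. *)
Definition enorm {R : realType} {m n : nat} (A : 'M[R]_(m, n)) : R :=
  Num.sqrt (\sum_i \sum_j A i j ^+ 2).

(* Paths and exponents are total functions on R; only their values on the
   interval of interest are ever used. *)

(* pairs (t, h) with t, t+h in [u,v] and 0 < |h| <= 1; h may be negative *)
Definition increments {R : realType} (u v : R) : set (R * R) :=
  [set p | [/\ u <= p.1 <= v, u <= p.1 + p.2 <= v & 0 < `|p.2| <= 1]].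

Definition regular_exponent {R : realType} (T : R) (a : R -> R) : Prop :=
  (ereal_sup [set (`|p.2| `^ (a p.1 - a (p.1 + p.2)))%:E
             | p in increments 0%R T] < +oo)%E.

(* a is in C([0,T]; (0,1)) *)
Definition var_exponent {R : realType} (T : R) (a : R -> R) : Prop :=
  {within `[0, T], continuous a} /\ forall t, 0 <= t <= T -> 0 < a t < 1.

(* For u < v the supremum is over a nonempty set of nonnegative reals, hence
   nonnegative; for u = v it would be -oo. *)
Definition var_hoelder {R : realType} {m n : nat} (a : R -> R)
    (g : R -> 'M[R]_(m, n)) (u v : R) : \bar R :=
  ereal_sup [set (enorm (g (p.1 + p.2) - g p.1) / `|p.2| `^ (a p.1))%:E
            | p in increments u v].

Definition var_hoelder_space {R : realType} {m n : nat} (T : R) (a : R -> R)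
    : set (R -> 'M[R]_(m, n)) :=
  [set g | (var_hoelder a g 0 T < +oo)%E].

(* As in [itv_partition s t P], the left endpoint s is not listed in P: the
   partition points are s :: P. *)
Definition mesh {R : realType} (s t : R) (P : seq R) : R :=
  \big[Num.max/0]_(0 <= k < size P)
    (nth t (s :: P) k.+1 - nth t (s :: P) k).

Definition partition_sum {R : realType} {V : zmodType} (Xi : R -> R -> V)
    (s t : R) (P : seq R) : V :=
  \sum_(0 <= k < size P) Xi (nth t (s :: P) k) (nth t (s :: P) k.+1).

(* The filter of partitions of [s, t] with mesh tending to 0 *)
Definition mesh_to0 {R : realType} (s t : R) : set_system (seq R) :=
  filter_from [set e : R | 0 < e]
    (fun e => [set P | itv_partition s t P /\ mesh s t P < e]).

(* The limit is for the library topology on matrices, which is the product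
   (hence Euclidean) one. *)
Definition sewing_integral {R : realType} {m n : nat}
    (Xi : R -> R -> 'M[R]_(m, n)) (s t : R) : 'M[R]_(m, n) :=
  lim (partition_sum Xi s t P @[P --> mesh_to0 s t]).

(* Main.v *)
(* For u <= w <= v the defect Xi u v - Xi u w - Xi w v equals
   (Y u - Y w) *m (X v - X w).  Both factors are estimated with the exponents at
   the middle point w, so the defect is at most M |v - u|^beta with beta > 1, and
   Young's argument applies: the Riemann sum over any partition of [u, v] is
   within K |v - u|^beta of Xi u v.  Applied on each interval of a partition of
   mesh at most e, this shows that refining it changes the Riemann sum by at most
   K e^(beta - 1) |v - u|, so the sums form a Cauchy filter. *)

Require Import Defs.
From mathcomp Require Import ring lra.

Set Implicit Arguments.
Unset Strict Implicit.
Unset Printing Implicit Defensive.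
Import Order.TTheory GRing.Theory Num.Theory.
Import numFieldNormedType.Exports.
Local Open Scope classical_set_scope.
Local Open Scope ring_scope.

(** * Cauchy-Schwarz and the Euclidean matrix norm *)

Lemma sum_Cauchy_Schwarz (R : realDomainType) (I : finType) (f g : I -> R) :
  (\sum_i f i * g i) ^+ 2 <= (\sum_i f i ^+ 2) * (\sum_i g i ^+ 2).
Proof.
(* Lagrange's identity: the gap in Cauchy-Schwarz is half a double sum of squares. *)
have lagrange : \sum_i \sum_j (f i * g j - f j * g i) ^+ 2 =
    2 * ((\sum_i f i ^+ 2) * (\sum_i g i ^+ 2) - (\sum_i f i * g i) ^+ 2).
  rewrite mulrBr expr2 !mulr_suml.
  under [in RHS]eq_bigr do rewrite mulr_sumr.
  under [X in _ - 2 * X]eq_bigr do rewrite mulr_sumr.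
  transitivity (\sum_i \sum_j (f i ^+ 2 * g j ^+ 2) +
      \sum_i \sum_j (f j ^+ 2 * g i ^+ 2) -
      2 * (\sum_i \sum_j (f i * g i * (f j * g j)))).
    rewrite mulr_sumr -big_split -sumrB; apply: eq_bigr => i _ /=.
    rewrite mulr_sumr -big_split -sumrB; apply: eq_bigr => j _ /=; ring.
  by rewrite [X in _ + X - _]exchange_big/=; ring.
have : 0 <= \sum_i \sum_j (f i * g j - f j * g i) ^+ 2.
  by apply: sumr_ge0 => i _; apply: sumr_ge0 => j _; exact: sqr_ge0.
by rewrite lagrange pmulr_rge0// subr_ge0.
Qed.

Section enorm.
Variable R : realType.

Lemma enorm_ge0 m n (A : 'M[R]_(m, n)) : 0 <= enorm A.
Proof. exact: sqrtr_ge0. Qed.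

Lemma sum_sqr_ge0 m n (A : 'M[R]_(m, n)) : 0 <= \sum_i \sum_j A i j ^+ 2.
Proof. by apply: sumr_ge0 => i _; apply: sumr_ge0 => j _; exact: sqr_ge0. Qed.

Lemma sqr_enorm m n (A : 'M[R]_(m, n)) :
  enorm A ^+ 2 = \sum_i \sum_j A i j ^+ 2.
Proof. by rewrite sqr_sqrtr// sum_sqr_ge0. Qed.

Lemma enorm0 m n : enorm (0 : 'M[R]_(m, n)) = 0.
Proof.
rewrite /enorm big1 ?sqrtr0// => i _; rewrite big1// => j _.
by rewrite mxE expr0n.
Qed.

Lemma enormN m n (A : 'M[R]_(m, n)) : enorm (- A) = enorm A.
Proof.
congr Num.sqrt; apply: eq_bigr => i _; apply: eq_bigr => j _.
by rewrite mxE sqrrN.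
Qed.

Lemma enormB m n (A B : 'M[R]_(m, n)) : enorm (A - B) = enorm (B - A).
Proof. by rewrite -enormN opprB. Qed.

Lemma ler_enormD m n (A B : 'M[R]_(m, n)) : enorm (A + B) <= enorm A + enorm B.
Proof.
rewrite -(ler_pXn2r (n := 2)) ?nnegrE ?addr_ge0 ?enorm_ge0//.
have CS : \sum_i \sum_j A i j * B i j <= enorm A * enorm B.
  apply: le_trans (ler_norm _) _.
  rewrite -(ler_pXn2r (n := 2)) ?nnegrE ?mulr_ge0 ?enorm_ge0// real_normK ?num_real//.
  rewrite exprMn !sqr_enorm !pair_bigA/=; exact: sum_Cauchy_Schwarz.
have -> : enorm (A + B) ^+ 2 =
    enorm A ^+ 2 + (\sum_i \sum_j A i j * B i j) *+ 2 + enorm B ^+ 2.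
  rewrite !sqr_enorm -sumrMnl -!big_split; apply: eq_bigr => i _ /=.
  rewrite -sumrMnl -!big_split; apply: eq_bigr => j _ /=.
  by rewrite mxE sqrrD.
by rewrite sqrrD lerD2r lerD2l ler_wMn2r.
Qed.

Lemma ler_enormB m n (A B C : 'M[R]_(m, n)) :
  enorm (A - C) <= enorm (A - B) + enorm (B - C).
Proof. by rewrite -[A - C](subrKA B); exact: ler_enormD. Qed.

(** Cauchy-Schwarz for row [i] of [A] and column [j] of [B], summed over [i] and [j]. *)
Lemma ler_enormM m d n (A : 'M[R]_(m, d)) (B : 'M[R]_(d, n)) :
  enorm (A *m B) <= enorm A * enorm B.
Proof.
rewrite -(ler_pXn2r (n := 2)) ?nnegrE ?mulr_ge0 ?enorm_ge0//.
rewrite exprMn !sqr_enorm mulr_suml; apply: ler_sum => i _.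
rewrite [X in _ * X]exchange_big mulr_sumr; apply: ler_sum => j _.
by rewrite mxE; exact: sum_Cauchy_Schwarz.
Qed.

(** Links [enorm] to the entrywise topology in which matrix limits are taken. *)
Lemma ler_coord_enorm m n (A : 'M[R]_(m, n)) i j : `|A i j| <= enorm A.
Proof.
rewrite -sqrtr_sqr ler_sqrt ?sum_sqr_ge0//.
rewrite (bigD1 i)//= (bigD1 j)//= -addrA lerDl addr_ge0//.
  by apply: sumr_ge0 => k _; exact: sqr_ge0.
by apply: sumr_ge0 => k _; apply: sumr_ge0 => l _; exact: sqr_ge0.
Qed.

Lemma enorm_continuous m n : continuous (@enorm R m n).
Proof.
move=> A; apply: (continuous_comp _ (@sqrt_continuous R _)).
apply: cvg_big => [||i _]; [exact: add_continuous|exact: nbhs_filter|].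
apply: cvg_big => [||j _]; [exact: add_continuous|exact: nbhs_filter|].
apply: (@cvg_comp _ _ _ (fun B : 'M[R]_(m, n) => B i j) (fun x : R => x ^+ 2) _ (nbhs (A i j))).
  exact: coord_continuous.
exact: exprn_continuous.
Qed.

End enorm.

(** * Riemann sums along a partition *)

Section partition_sum.
Variable R : realType.
Implicit Types (s t x : R) (P Q : seq R).

Lemma mesh_nil s t : mesh s t [::] = 0.
Proof. by rewrite /mesh big_nil. Qed.

Lemma mesh_cons s t x P : mesh s t (x :: P) = Num.max (x - s) (mesh x t P).
Proof. by rewrite /mesh big_nat_recl. Qed.

Section sum.
Variables (V : zmodType) (Xi : R -> R -> V).

Lemma partition_sum_nil s t : partition_sum Xi s t [::] = 0.
Proof. by rewrite /partition_sum big_nil. Qed.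

Lemma partition_sum_cons s t x P :
  partition_sum Xi s t (x :: P) = Xi s x + partition_sum Xi x t P.
Proof. by rewrite /partition_sum big_nat_recl. Qed.

(** [t'] is arbitrary: the end point only serves as default value of [nth], and all indices are in
    range. *)
Lemma partition_sum_cat s t t' P Q :
  partition_sum Xi s t (P ++ Q) =
  partition_sum Xi s t' P + partition_sum Xi (last s P) t Q.
Proof.
elim: P s => [|x P IH] s; first by rewrite partition_sum_nil add0r.
by rewrite /= !partition_sum_cons IH addrA.
Qed.

End sum.
End partition_sum.

(** * Refining, splitting and constructing partitions *)

Section itv_partition.
Variable R : realType.
Implicit Types (u v x y e : R) (P Q : seq R).

Lemma itv_partition_mem u v P y : itv_partition u v P -> y \in P -> u < y <= v.
Proof.
elim: P u => // x P IH u uvP; have xvP := itv_partition_cons uvP.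
case: (uvP) => /= /andP[ux _] _; rewrite inE => /predU1P[->|yP].
  by rewrite ux (itv_partition_le xvP).
by have /andP[xy ->] := IH x xvP yP; rewrite (lt_trans ux xy).
Qed.

Lemma itv_partition_catP u v P Q :
  itv_partition u v (P ++ Q) <->
  itv_partition u (last u P) P /\ itv_partition (last u P) v Q.
Proof.
rewrite /itv_partition cat_path last_cat eqxx; split.
  by move=> [/andP[-> ->] ->].
by move=> [[-> _] [-> ->]].
Qed.

Lemma common_refinement u v P Q : itv_partition u v P -> itv_partition u v Q ->
  exists2 S, itv_partition u v S & {subset P ++ Q <= S}.
Proof.
move=> uvP uvQ; pose S := sort <=%O (undup (P ++ Q)).
have memS : S =i P ++ Q by move=> y; rewrite mem_sort mem_undup.
have S_uv y : y \in S -> u < y <= v.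
  by rewrite memS mem_cat => /orP[]; exact: itv_partition_mem.
exists S => [|y]; last by rewrite memS.
have pS : path <%O u S.
  rewrite (path_sortedE lt_trans) sort_lt_sorted undup_uniq andbT.
  by apply/allP => y /S_uv /andP[].
split=> //.
(* [S] ends at [v]: if [u = v], no point fits into [S]; otherwise [v] is in [S], and nothing can
   follow it because all points are at most [v]. *)
have := mem_last u P; case: uvP => _ /eqP ->; rewrite inE => /predU1P[vu|vP].
  case: S S_uv {memS pS} => [|x S] S_uv; first by rewrite /= vu.
  have /andP[] := S_uv x (mem_head _ _).
  by move=> ux xv; have := lt_le_trans ux xv; rewrite vu ltxx.
have vS : v \in S by rewrite memS mem_cat vP.
case/splitPr: vS pS S_uv => S1 S2; rewrite cat_path last_cat => /andP[_ /=].
move=> /andP[_ /(order_path_min lt_trans)]; case: S2 => //= x S2 /andP[vx _].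
move=> /(_ x); rewrite mem_cat !inE eqxx !orbT => /(_ isT) /andP[_].
by rewrite leNgt vx.
Qed.

Lemma itv_partition_split u v c P : itv_partition u v P -> u <= c < v ->
  exists P1 x P2, P = P1 ++ x :: P2 /\ last u P1 <= c < x.
Proof.
elim: P u => [|x P IH] u uvP /andP[uc cv].
  by move: cv; rewrite -(itv_partition_nil uvP) ltNge uc.
have [xc|cx] := leP x c; last by exists [::], x, P; rewrite /= uc cx.
have [|P1 [y [P2 [-> H]]]] := IH x (itv_partition_cons uvP).
  by rewrite xc.
by exists (x :: P1), y, P2.
Qed.

(** Steps of length [e / 2], the last possibly shorter, by induction on their number. This makes the
    filter [mesh_to0] proper. *)
Lemma ex_mesh_lt u v e : 0 < e -> u <= v ->
  exists2 P, itv_partition u v P & mesh u v P < e.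
Proof.
move=> e0 uv; have h0 : 0 < e / 2 by rewrite divr_gt0.
have [n] : exists n, v - u <= (e / 2) *+ n.
  exists (Num.bound ((v - u) / (e / 2))).
  rewrite -mulr_natl -ler_pdivrMr// ltW// archi_boundP//.
  by rewrite divr_ge0 ?subr_ge0// ltW.
elim: n u uv => [|n IH] u uv vu.
  exists [::]; last by rewrite mesh_nil.
  by split=> //=; move: vu; rewrite mulr0n subr_le0 eq_le uv.
have [small|large] := leP (v - u) (e / 2).
  move: uv; rewrite le_eqVlt => /predU1P[->|uv].
    by exists [::]; [split => //=|rewrite mesh_nil].
  exists [:: v]; first exact: itv_partition1.
  by rewrite mesh_cons mesh_nil gt_max e0 andbT; lra.
have [||P xvP mP] := IH (u + e / 2); [lra|by move: vu; rewrite mulrS; lra|].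
exists (u + e / 2 :: P).
  by case: xvP => pP lP; split=> //=; rewrite pP andbT; lra.
by rewrite mesh_cons gt_max mP andbT; lra.
Qed.

Lemma mesh_to0_filter u v : u <= v -> ProperFilter (@mesh_to0 R u v).
Proof.
move=> uv; apply: filter_from_proper; last first.
  by by move=> e /= /ex_mesh_lt /(_ uv)[P]; exists P.
apply: filter_from_filter; first by exists 1 => /=.
move=> d e /= d0 e0; exists (Num.min d e); first by rewrite /= lt_min d0.
by move=> P /= [uvP]; rewrite lt_min => /andP[].
Qed.

End itv_partition.

(** * Young's argument for an almost additive [Xi] *)

Section sewing.
Variables (R : realType) (m n : nat) (Xi : R -> R -> 'M[R]_(m, n)).
Variables (a c b M K : R).
Hypotheses (b_gt1 : 1 < b) (M_ge0 : 0 <= M) (K_ge0 : 0 <= K).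
Hypothesis delta_le : forall u w v, a <= u -> u <= w -> w <= v -> v <= c ->
  enorm (Xi u v - Xi u w - Xi w v) <= M * (v - u) `^ b.
(* The induction proving [young_maximal] reproduces a bound with constant [K]
   as [K * 2 `^ (1 - b) + 2 * M]. *)
Hypothesis K_fix : K * 2 `^ (1 - b) + 2 * M = K.

Let b_gt0 : 0 < b. Proof. exact: lt_trans ltr01 b_gt1. Qed.

(** At [u = w = v] the defect is [- Xi u u], and its bound vanishes since [b > 0]. *)
Lemma sewing_diag u : a <= u <= c -> Xi u u = 0.
Proof.
move=> /andP[au uc]; have := delta_le au (lexx u) (lexx u) uc.
rewrite !subrr sub0r enormN powR0 ?mulr0; last exact: lt0r_neq0 b_gt0.
move=> Xu0; apply/matrixP => i j; rewrite mxE; apply/eqP.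
by rewrite -normr_le0; exact: le_trans (ler_coord_enorm _ _ _) Xu0.
Qed.

(* Cutting off the interval of the partition that contains the midpoint leaves
   two partitions of intervals of length at most [(v - u) / 2]. *)
Lemma young_maximal P u v : a <= u -> v <= c -> itv_partition u v P ->
  enorm (partition_sum Xi u v P - Xi u v) <= K * (v - u) `^ b.
Proof.
have [k] := ubnP (size P); elim: k P u v => // k IH P u v ltk au vc uvP.
have := itv_partition_le uvP; rewrite le_eqVlt => /predU1P[uv|uv].
  subst v; rewrite (itv_partitionxx uvP) partition_sum_nil sewing_diag ?au//.
  by rewrite subrr enorm0 subrr powR0 ?mulr0//; exact: lt0r_neq0 b_gt0.
have [|P1 [x [P2 [eP /andP[pmid midx]]]]] :=
    @itv_partition_split _ u v ((u + v) / 2) P uvP; first lra.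
rewrite {}eP in ltk uvP *.
move: uvP pmid => /itv_partition_catP; set p := last u P1 => -[upP1 pvP2] pmid.
have px : p < x by lra.
have xvP2 := itv_partition_cons pvP2.
have up : u <= p := itv_partition_le upP1.
have xv : x <= v := itv_partition_le xvP2.
rewrite size_cat/= addnS ltnS in ltk.
have lt1 := leq_ltn_trans (leq_addr _ _) ltk.
have lt2 := leq_ltn_trans (leq_addl _ _) ltk.
(* A piece of at most half the length costs at most half of the first summand in [K_fix], times the
   power of [v - u]. *)
have half w : 0 <= w -> w <= (v - u) / 2 ->
    K * w `^ b <= K * 2 `^ (1 - b) / 2 * (v - u) `^ b.
  move=> w0 wl; rewrite -!mulrA; apply: ler_wpM2l => //.
  have -> : 2 `^ (1 - b) * (2^-1 * (v - u) `^ b) = ((v - u) / 2) `^ b.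
    rewrite powRM ?subr_ge0 ?invr_ge0 ?(ltW uv)// -powR_inv1// -powRrM.
    rewrite [RHS]mulrC mulrA -powRD; last by apply/implyP.
    by congr (2 `^ _ * _); ring.
  by rewrite ge0_ler_powR ?(ltW b_gt0)// nnegrE; lra.
have pc : p <= c := le_trans (ltW px) (le_trans xv vc).
have ax : a <= x := le_trans au (le_trans up (ltW px)).
have K1 := le_trans (IH P1 u p lt1 au pc upP1) (half (p - u) ltac:(lra) ltac:(lra)).
have K2 := le_trans (IH P2 x v lt2 ax vc xvP2) (half (v - x) ltac:(lra) ltac:(lra)).
have D1 : enorm (Xi u x - Xi u p - Xi p x) <= M * (v - u) `^ b.
  apply: le_trans (delta_le au up (ltW px) (le_trans xv vc)) _.
  by rewrite ler_wpM2l// ge0_ler_powR ?(ltW b_gt0) ?nnegrE//; lra.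
have D2 := delta_le au (le_trans up (ltW px)) xv vc.
rewrite (partition_sum_cat _ _ _ p) partition_sum_cons -/p.
(* The errors of the two shorter sums, then two defects: of [[u, x]] cut at [p] and of [[u, v]] cut
   at [x]. The defects account for [2 * M] in [K_fix]. *)
have -> : partition_sum Xi u p P1 + (Xi p x + partition_sum Xi x v P2) - Xi u v
  = (partition_sum Xi u p P1 - Xi u p) + (partition_sum Xi x v P2 - Xi x v)
    + - (Xi u x - Xi u p - Xi p x) + - (Xi u v - Xi u x - Xi x v).
  apply/matrixP => i j; rewrite !mxE; ring.
have -> : K * (v - u) `^ b =
  K * 2 `^ (1 - b) / 2 * (v - u) `^ b + K * 2 `^ (1 - b) / 2 * (v - u) `^ b
  + M * (v - u) `^ b + M * (v - u) `^ b.
  by rewrite -{1}K_fix; field.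
do 3 ?[apply: le_trans (ler_enormD _ _) _; rewrite ?enormN; apply: lerD => //].
Qed.

(** Induction on [P]: [S] is cut at the first point [x] of [P]; [young_maximal] handles the part up
    to [x], the induction hypothesis the rest. *)
Lemma refinement_le P S u v e : a <= u -> v <= c -> mesh u v P <= e ->
  itv_partition u v P -> itv_partition u v S -> {subset P <= S} ->
  enorm (partition_sum Xi u v S - partition_sum Xi u v P)
    <= K * e `^ (b - 1) * (v - u).
Proof.
elim: P S u => [|x P IH] S u au vc meshP uvP uvS PS.
  have uv := itv_partition_nil uvP; subst v.
  by rewrite (itv_partitionxx uvS) !subrr enorm0 mulr0.
rewrite mesh_cons ge_max in meshP; case/andP: meshP => xue meshP.
have xvP := itv_partition_cons uvP.
have /andP[ux xv] := itv_partition_mem uvP (mem_head _ _).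
have : x \in S by rewrite PS ?mem_head.
move=> xS; case/splitPr: xS uvS PS => S1 S2.
rewrite -cat_rcons => /itv_partition_catP; rewrite last_rcons => -[uxS1 xvS2] PS.
have PS2 : {subset P <= S2}.
  move=> y yP; have /andP[xy _] := itv_partition_mem xvP yP.
  have := PS y; rewrite inE yP orbT mem_cat => /(_ isT) /orP[]// yS1.
  by have /andP[_] := itv_partition_mem uxS1 yS1; rewrite leNgt xy.
have A1 := young_maximal au (le_trans xv vc) uxS1.
have A2 := IH S2 x (le_trans au (ltW ux)) vc meshP xvP xvS2 PS2.
rewrite (partition_sum_cat _ _ _ x) last_rcons partition_sum_cons.
rewrite opprD addrACA; apply: le_trans (ler_enormD _ _) _.
have -> : v - u = (x - u) + (v - x) by ring.
rewrite mulrDr; apply: lerD => //; apply: le_trans A1 _.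
(* One factor [x - u] is split off, so that the lengths add up to [v - u]; the remaining power, of
   exponent [b - 1], is bounded through the mesh. *)
rewrite -mulrA ler_wpM2l// -(@mulr_powRB1 _ (x - u)) ?subr_ge0 ?(ltW ux)//.
rewrite mulrC ler_wpM2r ?subr_ge0 ?(ltW ux)//.
by rewrite ge0_ler_powR ?subr_ge0 ?(ltW b_gt1) ?nnegrE//; lra.
Qed.

(** Both sums are compared with the one over a common refinement, whence the factor 2. *)
Lemma mesh_le_cauchy P Q u v e : a <= u -> v <= c ->
  itv_partition u v P -> mesh u v P <= e ->
  itv_partition u v Q -> mesh u v Q <= e ->
  enorm (partition_sum Xi u v P - partition_sum Xi u v Q)
    <= 2 * (K * e `^ (b - 1) * (v - u)).
Proof.
move=> au vc uvP meshP uvQ meshQ.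
have [S uvS PQS] := common_refinement uvP uvQ.
apply: le_trans (ler_enormB _ (partition_sum Xi u v S) _) _.
rewrite mulr_natl mulr2n enormB.
by apply: lerD; apply: refinement_le => // x xPQ;
  rewrite PQS// mem_cat xPQ ?orbT.
Qed.

Lemma sewing_cvg u v : a <= u -> u < v -> v <= c ->
  cvg (partition_sum Xi u v P @[P --> mesh_to0 u v]).
Proof.
move=> au uv vc.
have FF := mesh_to0_filter (ltW uv).
apply: cauchy_cvg; apply: cauchy_exP => eps eps0.
have L0 : 0 < 2 * (K * (v - u)) + 1.
  by rewrite ltr_wpDl// !mulr_ge0// subr_ge0 ltW.
(* Chosen to bring the Cauchy bound below [eps]; the [+ 1] keeps the denominator positive even for
   [K = 0] and makes the final inequality strict. *)
pose e := (eps / (2 * (K * (v - u)) + 1)) `^ (b - 1)^-1.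
have e0 : 0 < e by apply/powR_gt0/divr_gt0.
have eb : e `^ (b - 1) = eps / (2 * (K * (v - u)) + 1).
  by rewrite -powRrM mulVf ?powRr1 ?divr_ge0 ?(ltW eps0) ?(ltW L0)// subr_eq0 gt_eqF.
have [P uvP /ltW meshP] := ex_mesh_lt e0 (ltW uv).
exists (partition_sum Xi u v P); exists e => //= Q [uvQ /ltW meshQ].
split=> // i j; rewrite /ball/=.
have := mesh_le_cauchy au vc uvP meshP uvQ meshQ.
move/(le_trans (ler_coord_enorm _ i j)); rewrite !mxE => /le_lt_trans; apply.
rewrite eb.
rewrite [ltLHS](_ : _ = eps * (2 * (K * (v - u)) / (2 * (K * (v - u)) + 1))).
  by rewrite gtr_pMr// ltr_pdivrMr// mul1r ltrDl.
ring.
Qed.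

(** The bound of [young_maximal] is a closed condition, so it passes to the limit. *)
Lemma sewing_bound u v : a <= u -> u < v -> v <= c ->
  enorm (sewing_integral Xi u v - Xi u v) <= K * (v - u) `^ b.
Proof.
move=> au uv vc.
have FF := mesh_to0_filter (ltW uv).
have Icvg : (enorm (partition_sum Xi u v P - Xi u v)) @[P --> mesh_to0 u v] -->
    enorm (sewing_integral Xi u v - Xi u v).
  apply: cvg_comp; last exact: enorm_continuous.
  apply: cvgB; [exact: sewing_cvg|exact: cvg_cst].
apply: (@closed_cvg _ _ _ FF _ (fun x : R => x <= K * (v - u) `^ b) _ _ _ Icvg).
  exact: closed_le.
by exists 1 => //= P [uvP _]; exact: young_maximal.
Qed.

End sewing.

(** Ensures that the equation [K_fix] has a nonnegative solution [K]. *)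
Lemma pow2B_lt1 (R : realType) (b : R) : 1 < b -> 2 `^ (1 - b) < 1 :> R.
Proof.
move=> b_gt1; rewrite -opprB powRN invf_lt1 ?powR_gt0//.
have b1 : 0 < b - 1 by rewrite subr_gt0.
have := gt0_ltr_powR b1 (_ : 1 \is Num.nneg) (_ : 2 \is Num.nneg).
by rewrite powR1; apply; rewrite ?nnegrE// ltr1n.
Qed.

(** * Hoelder bounds with variable exponent *)

Section var_hoelder.
Variables (R : realType) (m n : nat) (al : R -> R) (g : R -> 'M[R]_(m, n)).
Implicit Types (s t u w : R).

(** Trades the supremum for a real [H], finite by comparison with [[0, T]]. The exponent sits at
    [w], the base point of the increment [u - w] of either sign. *)
Lemma var_hoelderP T s t : 0 <= s -> s < t -> t <= T ->
  var_hoelder_space T al g ->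
  exists2 H : R, 0 <= H & var_hoelder al g s t = H%:E /\
    forall u w, s <= u <= t -> s <= w <= t -> `|u - w| <= 1 ->
      enorm (g u - g w) <= H * `|u - w| `^ al w.
Proof.
move=> s0 st tT gfin.
have hle : (var_hoelder al g s t <= var_hoelder al g 0 T)%E.
  apply: le_ereal_sup => _ [p [/andP[p1 p2] /andP[p3 p4] p5] <-].
  exists p => //; split=> //; apply/andP; split; lra.
have quot u w : s <= u <= t -> s <= w <= t -> `|u - w| <= 1 -> u != w ->
    ((enorm (g u - g w) / `|u - w| `^ al w)%:E <= var_hoelder al g s t)%E.
  move=> ust wst uw1 uw; apply: ereal_sup_ubound; exists (w, u - w).
    split=> //=; first by rewrite addrC subrK.
    by rewrite uw1 normr_gt0 subr_eq0 uw.
  by rewrite /= [w + _]addrC subrK.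
have hge : (0 <= var_hoelder al g s t)%E.
  (* An admissible increment from [s], capped at length 1: its quotient shows that the supremum is
     nonnegative. *)
  pose u := Num.min t (s + 1).
  have su : s < u by rewrite lt_min st ltrDl ltr01.
  have ut : u <= t by rewrite ge_min lexx.
  have us1 : u <= s + 1 by rewrite ge_min lexx orbT.
  apply: le_trans (quot u s _ _ _ _); last by rewrite gt_eqF.
  - by rewrite lee_fin divr_ge0 ?enorm_ge0 ?powR_ge0.
  - by rewrite ut (ltW su).
  - by rewrite lexx ltW.
  - by rewrite ger0_norm; lra.
have hfin : var_hoelder al g s t \is a fin_num.
  by rewrite ge0_fin_numE// (le_lt_trans hle).
exists (fine (var_hoelder al g s t)); first exact: fine_ge0.
split=> [|u w ust wst uw1]; first by rewrite fineK.
have [->|uw] := eqVneq u w.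
  by rewrite subrr enorm0 mulr_ge0 ?fine_ge0 ?powR_ge0.
rewrite -ler_pdivrMr ?powR_gt0 ?normr_gt0 ?subr_eq0//.
by rewrite -lee_fin fineK// quot.
Qed.

(* Since [al >= 0], chaining steps of length at most 1 extends the local bound
   to all increments. *)
Lemma hoelder_global s t (N : nat) (H : R) : 0 <= H ->
  (forall u, s <= u <= t -> 0 <= al u) -> (0 < N)%N -> t - s <= N%:R ->
  (forall u w, s <= u <= t -> s <= w <= t -> `|u - w| <= 1 ->
     enorm (g u - g w) <= H * `|u - w| `^ al w) ->
  forall u w, s <= u <= t -> s <= w <= t ->
    enorm (g u - g w) <= N%:R * H * `|u - w| `^ al w.
Proof.
move=> H0 al0 N0 tsN local u w ust wst.
have N1 : 1 <= N%:R :> R by rewrite ler1n.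
have [uw1|uw1] := leP `|u - w| 1.
  apply: le_trans (local u w ust wst uw1) _.
  by rewrite -mulrA ler_peMl// mulr_ge0 ?powR_ge0.
(* Unit steps followed by a shorter one; each costs at most [H], as a length at most 1 has powers at
   most 1. *)
have chain (k : nat) x y : s <= x -> x <= y -> y <= t -> y - x <= k%:R ->
    enorm (g y - g x) <= k%:R * H.
  elim: k x => [|k IH] x sx xy yt yxk.
    by rewrite (_ : y = x) ?subrr ?enorm0 ?mul0r//; lra.
  have step z : x <= z -> z <= t -> z - x <= 1 -> enorm (g z - g x) <= H.
    move=> xz zt zx1.
    have nzx : `|z - x| = z - x by rewrite ger0_norm ?subr_ge0.
    have xst : s <= x <= t by rewrite sx (le_trans xy yt).
    have zst : s <= z <= t by rewrite zt (le_trans sx xz).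
    have := local z x zst xst; rewrite nzx => /(_ zx1) /le_trans; apply.
    rewrite ler_piMr//; have <- : 1 `^ al x = 1 by rewrite powR1.
    by rewrite ge0_ler_powR ?al0// nnegrE ?subr_ge0.
  have [yx1|yx1] := leP (y - x) 1.
    by rewrite (le_trans (step y xy yt yx1))// ler_peMl// ler1n.
  apply: le_trans (ler_enormB _ (g (x + 1)) _) _.
  rewrite -natr1 mulrDl mul1r; apply: lerD.
    by apply: IH; move: yxk; rewrite -?natr1; lra.
  by apply: step; lra.
have : enorm (g u - g w) <= N%:R * H.
  case/andP: ust => su ut; case/andP: wst => sw wt.
  have [wu|/ltW uw] := leP w u; first by apply: chain => //; lra.
  by rewrite enormB; apply: chain => //; lra.
(* Here [u] and [w] are more than 1 apart, so the power of their distance is at least 1. *)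
move/le_trans; apply; rewrite ler_peMr ?mulr_ge0//.
have := ler_powR (ltW uw1) (al0 w wst); by rewrite powRr0.
Qed.

End var_hoelder.

(** For [L <= 1] a smaller exponent gives a larger power; for [L > 1] both factors are at most
    [T + 1] and the power on the right is at least 1. *)
Lemma powR_mul_le (R : realType) (L T p q b : R) : 0 <= L <= T ->
  0 < p < 1 -> 0 < q < 1 -> 0 <= b -> b <= p + q ->
  L `^ p * L `^ q <= (T + 1) ^+ 2 * L `^ b.
Proof.
move=> /andP[L0 LT] /andP[p0 p1] /andP[q0 q1] b0 bpq.
have T1 : 1 <= T + 1 by rewrite lerDr (le_trans L0).
have [L1|/ltW L1] := leP L 1.
  move: L0; rewrite le_eqVlt => /predU1P[<-|L0].
    by rewrite powR0 ?gt_eqF// mul0r mulr_ge0 ?powR_ge0// exprn_ge0// (le_trans ler01).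
  rewrite -powRD; last by rewrite (gt_eqF L0) implybT.
  apply: (@le_trans _ _ (L `^ b)); first by rewrite ger_powR ?L0.
  by rewrite ler_peMl ?powR_ge0// exprn_ege1.
have bound r : r < 1 -> L `^ r <= T + 1.
  by move=> /ltW /(ler1_powR L1) /le_trans; apply; rewrite (le_trans LT)// lerDl.
apply: (@le_trans _ _ ((T + 1) ^+ 2)).
  by rewrite expr2 ler_pM ?powR_ge0 ?bound.
rewrite ler_peMr ?exprn_ge0 ?(le_trans ler01)//.
by have := ler_powR L1 b0; rewrite powRr0.
Qed.

(** * Young's bound with variable exponents *)

Theorem proposition6 (R : realType) (T : R) (alpha gamma : R -> R)
  (T_gt0 : 0 < T)
  (alpha_exp : var_exponent T alpha) (gamma_exp : var_exponent T gamma)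
  (alpha_reg : regular_exponent T alpha) (gamma_reg : regular_exponent T gamma) :
  let beta := inf [set alpha t + gamma t | t in `[0, T]] in
  1 < beta ->
  exists C : R, forall (m d n : nat)
    (Y : R -> 'M[R]_(m, d)) (X : R -> 'M[R]_(d, n)),
    var_hoelder_space T gamma Y -> var_hoelder_space T alpha X ->
    let Xi := fun s t : R => Y s *m (X t - X s) in
    forall s t : R, 0 <= s -> s < t -> t <= T ->
      cvg (partition_sum Xi s t P @[P --> mesh_to0 s t]) /\
      ((enorm (sewing_integral Xi s t - Xi s t))%:E
         <= C%:E * var_hoelder gamma Y s t * var_hoelder alpha X s t
            * (`|t - s| `^ beta)%:E)%E.
Proof.
move=> beta beta_gt1.
have [alpha01 gamma01] := (alpha_exp.2, gamma_exp.2).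
have betaP w : 0 <= w <= T -> beta <= alpha w + gamma w.
  move=> wT; apply: ge_inf; last by exists w => //=; rewrite in_itv.
  exists 0 => _ [r /= rT <-]; rewrite in_itv/= in rT.
  by have := alpha01 r rT; have := gamma01 r rT; lra.
(* [N] steps of length at most 1 span any [[s, t]] inside [[0, T]]. *)
pose N := Num.bound T.
have TN : T < N%:R by rewrite archi_boundP// ltW.
have N0 : (0 < N)%N by rewrite -(ltr0n R) (lt_trans T_gt0).
(* One [N] per path from [hoelder_global], and the square of [T + 1] from [powR_mul_le]. Then [C]
   solves the equation of [K_fix] for [M = D]. *)
pose D : R := N%:R ^+ 2 * (T + 1) ^+ 2.
pose C := 2 * D / (1 - 2 `^ (1 - beta)).
have D0 : 0 <= D by rewrite mulr_ge0 ?sqr_ge0.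
have C0 : 0 <= C.
  by apply: divr_ge0; [exact: mulr_ge0|rewrite subr_ge0 ltW// pow2B_lt1].
have CD : C * 2 `^ (1 - beta) + 2 * D = C.
  by rewrite /C; field; rewrite subr_eq0 gt_eqF// pow2B_lt1.
exists C => m d n Y X Yfin Xfin Xi s t s0 st tT.
(* The seminorms are those of [[s, t]], as the bound requires; the sewing section is then used with
   [a = s] and [c = t]. *)
have [HY HY0 [-> localY]] := var_hoelderP s0 st tT Yfin.
have [HX HX0 [-> localX]] := var_hoelderP s0 st tT Xfin.
have inT w : s <= w <= t -> 0 <= w <= T by lra.
have tsN : t - s <= N%:R by lra.
have globalY := hoelder_global HY0
  (fun w ws => ltW (andP (gamma01 w (inT w ws))).1) N0 tsN localY.
have globalX := hoelder_global HX0
  (fun w ws => ltW (andP (alpha01 w (inT w ws))).1) N0 tsN localX.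
have HYX0 : 0 <= HY * HX by rewrite mulr_ge0.
have delta u w v : s <= u -> u <= w -> w <= v -> v <= t ->
    enorm (Xi u v - Xi u w - Xi w v) <= D * (HY * HX) * (v - u) `^ beta.
  move=> su uw wv vt.
  have [ust [wst vst]] : s <= u <= t /\ s <= w <= t /\ s <= v <= t.
    by split; [|split]; lra.
  have -> : Xi u v - Xi u w - Xi w v = (Y u - Y w) *m (X v - X w).
    by rewrite /Xi -mulmxBr opprB addrA subrK -mulmxBl.
  apply: le_trans (ler_enormM _ _) _.
  (* Both exponents are taken at the middle point [w], which the Hoelder
     seminorms allow because their increments may be negative. *)
  apply: le_trans (ler_pM (enorm_ge0 _) (enorm_ge0 _)
    (globalY u w ust wst) (globalX v w vst wst)) _.
  have /andP[alpha0 _] := alpha01 w (inT w wst).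
  have /andP[gamma0 _] := gamma01 w (inT w wst).
  have uw_le : `|u - w| `^ gamma w <= (v - u) `^ gamma w.
    by rewrite ge0_ler_powR ?(ltW gamma0) ?nnegrE ?normr_ge0// ?ler_norml; lra.
  have vw_le : `|v - w| `^ alpha w <= (v - u) `^ alpha w.
    by rewrite ge0_ler_powR ?(ltW alpha0) ?nnegrE ?normr_ge0// ?ler_norml; lra.
  have L0T : 0 <= v - u <= T by lra.
  have bound : `|u - w| `^ gamma w * `|v - w| `^ alpha w
      <= (T + 1) ^+ 2 * (v - u) `^ beta.
    apply: le_trans (ler_pM (powR_ge0 _ _) (powR_ge0 _ _) uw_le vw_le) _.
    apply: powR_mul_le => //; [exact: gamma01 (inT _ _)|exact: alpha01 (inT _ _)| |].
      exact: ltW (lt_trans ltr01 beta_gt1).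
    by rewrite addrC; exact: betaP (inT _ _).
  rewrite [leLHS](_ : _ = N%:R ^+ 2 * (HY * HX) *
    (`|u - w| `^ gamma w * `|v - w| `^ alpha w)); last by ring.
  rewrite [leRHS](_ : _ = N%:R ^+ 2 * (HY * HX) *
    ((T + 1) ^+ 2 * (v - u) `^ beta)); last by rewrite /D; ring.
  by rewrite ler_wpM2l// mulr_ge0// sqr_ge0.
(* The equation is linear, so it scales by [HY * HX] and [C] stays independent of the paths. *)
have K_fix : C * (HY * HX) * 2 `^ (1 - beta) + 2 * (D * (HY * HX)) = C * (HY * HX).
  by rewrite -[RHS](congr1 (fun x => x * (HY * HX)) CD); ring.
split; first exact: (sewing_cvg beta_gt1 (mulr_ge0 D0 HYX0) (mulr_ge0 C0 HYX0) delta K_fix).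
rewrite -!EFinM lee_fin gtr0_norm ?subr_gt0// -(mulrA C).
exact: (sewing_bound beta_gt1 (mulr_ge0 D0 HYX0) (mulr_ge0 C0 HYX0) delta K_fix).
Qed.
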